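(* Let $n\ge1$ be an integer, $q=2^n$, and let $N_{13}$ denote the total number of orbits of $G=\mathrm{PSL}(2,2^n)$ acting on the $13$-element subsets of the projective line $X=\mathrm{GF}(2^n)\cup\{\infty\}$. Define \[X_{1,n}=\tfrac{1}{6227020800}(q-2)(q-3)(q-4)(q-5)(q-6)(q-7)(q-8)(q-9)(q-10)(q-11),\] \[X_{2,n}=\tfrac{1}{46080}(q-2)(q-4)(q-6)(q-8)(q-10),\qquad X_{3,n}=\tfrac{1}{972}(q-4)(q-7)(q-10),\] and $X_n=X_{1,n}+X_{2,n}+X_{3,n}$. Then \[N_{13}=\begin{cases} X_n & \text{if } n\equiv 2,4,8,14,16,22,26,28,32,34,38,44,46,52,56,58 \pmod{60},\\ X_n+\frac{5}{11} & \text{if } n\equiv 10,20,40,50\pmod{60},\\ X_n+\frac{6}{13} & \text{if } n\equiv 6,12,18,24,36,42,48,54\pmod{60},\\ X_n+\frac{131}{143} & \text{if } n\equiv 0,30\pmod{60},\ n>0,\\ X_{1,n}+X_{2,n} & \text{if } n \text{ is odd}. \end{cases}\]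
   Context: $\mathrm{PSL}(2,2^n)$ is the group of all maps $X\to X$, $x\mapsto\frac{ax+b}{cx+d}$ with $a,b,c,d\in\mathrm{GF}(2^n)$, $ad-bc\neq0$ (usual conventions for $\infty$), acting on $13$-subsets by $g(B)=\{g(x):x\in B\}$. *)

(* Defs.v *)
From Stdlib Require Import BinPos BinNat.
From HB Require Import structures.
From mathcomp Require Import all_boot all_order all_fingroup all_algebra.
From mathcomp Require Import ring.

Set Implicit Arguments.
Unset Strict Implicit.
Unset Printing Implicit Defensive.

Import GRing.Theory.
Local Open Scope ring_scope.

Section Moebius.

Variable F : fieldType.

(* The projective line F \cup {infinity} is [option F], with [None] as the    *)
(* point at infinity.  [ratio u v] is the point u / v, for (u, v) != (0, 0).  *)
Definition ratio (u v : F) : option F :=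
  if v == 0 then None else Some (u / v).

Definition moebius (a b c d : F) (x : option F) : option F :=
  if x is Some y then ratio (a * y + b) (c * y + d) else ratio a c.

Lemma ratioZ (k u v : F) : k != 0 -> ratio (k * u) (k * v) = ratio u v.
Proof.
move=> k0; rewrite /ratio mulf_eq0 (negPf k0) /=.
by case: eqP => // _; rewrite -mulf_div divff ?mul1r.
Qed.

Lemma moebius_ratio (a b c d u v : F) : (u != 0) || (v != 0) ->
  moebius a b c d (ratio u v) = ratio (a * u + b * v) (c * u + d * v).
Proof.
rewrite {1}/ratio; have [-> | v0] := eqVneq v 0.
  by rewrite orbF => u0; rewrite !mulr0 !addr0 /= ![_ * u]mulrC ratioZ.
by move=> _ /=; rewrite -(ratioZ _ _ v0); congr ratio; field.
Qed.

Lemma moebius_comp (a b c d a' b' c' d' : F) (x : option F) :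
    a * d - b * c != 0 ->
  moebius a' b' c' d' (moebius a b c d x) =
  moebius (a' * a + b' * c) (a' * b + b' * d)
          (c' * a + d' * c) (c' * b + d' * d) x.
Proof.
move=> D0; case: x => [x|] /=; rewrite moebius_ratio.
- by congr ratio; ring.
- rewrite -negb_and; apply: contra D0 => /andP[/eqP u0 /eqP v0].
  have [c0 | c0] := eqVneq c 0.
    by move: v0; rewrite c0 mul0r add0r => ->; rewrite !mulr0 subr0.
  rewrite -(mulrI_eq0 _ (mulfI c0)); apply/eqP.
  transitivity (a * c * (c * x + d) - c * c * (a * x + b)); first by ring.
  by rewrite u0 v0 !mulr0 subr0.
- by [].
- rewrite -negb_and; apply: contra D0 => /andP[/eqP-> /eqP->].
  by rewrite mul0r mulr0 subr0.
Qed.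

Lemma moebius_scalar (k : F) (x : option F) : k != 0 -> moebius k 0 0 k x = x.
Proof.
move=> k0; case: x => [x|] /=; rewrite /ratio ?eqxx //.
by rewrite mul0r add0r addr0 (negPf k0) mulrAC divff ?mul1r.
Qed.

Lemma moebius_inj (a b c d : F) :
  a * d - b * c != 0 -> injective (moebius a b c d).
Proof.
move=> D0; apply: (can_inj (g := moebius d (- b) (- c) a)) => x.
rewrite moebius_comp // -[RHS](moebius_scalar x D0).
by congr moebius; ring.
Qed.

End Moebius.

Section PSL2.

Variable F : finFieldType.

(* For F of characteristic 2 every element is a square, so that asking for a  *)
(* nonzero determinant is the same as asking for determinant 1, and the group *)
(* below is both PGL(2, F) and PSL(2, F).                                     *)
Definition PSL2 : {set {perm option F}} :=
  [set s : {perm option F} | [exists a : F, exists b : F, exists c : F, exists d : F,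
     (a * d - b * c != 0) && [forall x, s x == moebius a b c d x]]].

Lemma PSL2P (s : {perm option F}) :
  reflect (exists a b c d : F, a * d - b * c != 0 /\ s =1 moebius a b c d)
          (s \in PSL2).
Proof.
rewrite inE; apply: (iffP existsP) => [[a /existsP[b /existsP[c /existsP[d]]]]|].
  by case/andP=> D0 /forallP sE; exists a, b, c, d; split=> // x; apply/eqP.
case=> a [b [c [d [D0 sE]]]]; exists a; apply/existsP; exists b.
apply/existsP; exists c; apply/existsP; exists d; rewrite D0.
by apply/forallP=> x; rewrite sE.
Qed.

(* No Moebius map is lost by working inside {perm option F}.                  *)
Lemma mem_PSL2_moebius (a b c d : F) (D0 : a * d - b * c != 0) :
  perm (moebius_inj D0) \in PSL2.
Proof. by apply/PSL2P; exists a, b, c, d; split=> // x; rewrite permE. Qed.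

Lemma PSL2_group_set : group_set PSL2.
Proof.
apply/group_setP; split=> [|s t].
  apply/PSL2P; exists 1, 0, 0, 1.
  rewrite !mulr1 !mulr0 subr0 oner_neq0; split=> // x.
  by rewrite perm1 moebius_scalar ?oner_neq0.
case/PSL2P=> a [b [c [d [D0 sE]]]] /PSL2P[a' [b' [c' [d' [D0' tE]]]]].
apply/PSL2P; exists (a' * a + b' * c), (a' * b + b' * d).
exists (c' * a + d' * c), (c' * b + d' * d); split=> [|x].
  rewrite [X in X != _](_ : _ = (a' * d' - b' * c') * (a * d - b * c)).
    by rewrite mulf_neq0.
  by ring.
by rewrite permM tE sE moebius_comp.
Qed.

Canonical PSL2_group := group PSL2_group_set.

(* ['P^* ] sends a subset B of the projective line to its image under g.      *)
Definition N13 : nat :=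
  #|orbit ('P^*)%act PSL2 @: [set B : {set option F} | #|B| == 13]|.

End PSL2.

(* Large literals are of type N, since unary ones are intractable.            *)
Lemma fact13E : nat_of_bin 6227020800 = 13`!.
Proof.
have -> : 6227020800%num = Npos (foldr Pos.mul 720%positive
  [:: 13; 12; 11; 10; 9; 8; 7]%positive) by [].
rewrite /nat_of_bin /foldr !nat_of_mul_pos.
rewrite (factS 12) (factS 11) (factS 10) (factS 9) (factS 8) (factS 7) (factS 6).
by do 7![congr (_ * _)%N => //].
Qed.

Definition X1 (n : nat) : rat :=
  let q : rat := (2 ^ n)%:R in
  1 / (nat_of_bin 6227020800)%:R
  * ((q - 2) * (q - 3) * (q - 4) * (q - 5) * (q - 6)
     * (q - 7) * (q - 8) * (q - 9) * (q - 10) * (q - 11)).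

Definition X2 (n : nat) : rat :=
  let q : rat := (2 ^ n)%:R in
  1 / (nat_of_bin 46080)%:R * ((q - 2) * (q - 4) * (q - 6) * (q - 8) * (q - 10)).

Definition X3 (n : nat) : rat :=
  let q : rat := (2 ^ n)%:R in
  1 / 972 * ((q - 4) * (q - 7) * (q - 10)).

Definition Xtot (n : nat) : rat := X1 n + X2 n + X3 n.

(* Main.v *)
Require Import Defs.
From mathcomp Require Import all_boot all_order all_fingroup all_algebra.
From mathcomp Require Import all_solvable all_field.
From mathcomp Require Import ring zify.

Set Implicit Arguments.
Unset Strict Implicit.
Unset Printing Implicit Defensive.

Import GRing.Theory Num.Theory.
Local Open Scope ring_scope.

(** The count is Burnside's lemma for G = PSL(2, q) = SL(2, q), q = 2^n, acting
    on the 13-subsets of the line F + infinity; the work is in finding, for each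
    g in G, the number of 13-subsets stable under g, without classifying the
    conjugacy classes.

    Everything is read off from the trace t of the matrix M of g.  By
    Cayley-Hamilton g^k is given by U_k M - U_(k-1), where U_k = U_k(t) follows
    the Chebyshev recurrence U_(k+2) = t U_(k+1) - U_k.  When U_k is nonzero
    this matrix has the same fixed points as M, when U_k = 0 it is scalar
    ([iter_moebius_fix]).  So all points moved by g lie in orbits of one and the
    same length, the order d of g, and d divides k exactly when U_k(t) = 0.
    The fixed points of g correspond to the roots of y^2 - t y + 1 in F; there
    are r = 1 of them for t = 0 (involutions) and r = 0 or 2 otherwise.  A
    stable 13-subset consists of i fixed points and j orbits of length d with
    i + d j = 13 ([card_stable_sets]), where q + 1 = r + d m for the number m of
    all such orbits.  For t <> 0 the order d is odd, as q + 1 - r is, so only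
    d = 13, or r = 2 and d = 11 or 3, contribute ([order_of_trace]).

    A trace t is taken by q (q - 1 + r) matrices ([card_sl2_trace]), and
    (q - 1 + r) (q + 1 - r) = q^2 - 1 for r = 0 and r = 2.  Hence each trace of
    order 13 contributes 1 / 13 to the number of orbits, whether or not g has
    fixed points; each trace of order 11 with r = 2 contributes 1 / 11; and the
    trace 1, of order 3, contributes X3 when r = 2 ([sum_trace_weight]).  The
    identity and the involutions give X1 and X2 ([sum_trace0]).

    The traces remain to be counted.  In characteristic 2, U_(2k+1) is the
    square of psi_k = U_(k+1) + U_k, and psi_5 and psi_6 have degrees 5 and 6.
    They divide X^32 - X and X^64 - X respectively, hence X^q - X when 5,
    respectively 6, divides n, and then all their roots lie in F.  Conversely
    q + 1 = r + d m shows that a root of psi_6 in F forces 13 | q^2 - 1, and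
    hence 6 | n, and that for a root of psi_5 in F one has r = 2 exactly when
    11 | q - 1, that is, 10 | n; likewise r = 2 for the trace 1 exactly when n
    is even. *)

(** * Subsets stable under a permutation whose nontrivial orbits are equal *)

Definition stable_sets (T : finType) (s : {perm T}) k :=
  [set B : {set T} | (s @: B == B) && (#|B| == k)].

Lemma sum_powerset_card (U : finType) (A : {set U}) (F : nat -> nat) :
  (\sum_(P in powerset A) F #|P| = \sum_(i < #|A|.+1) 'C(#|A|, i) * F i)%N.
Proof.
rewrite (partition_big
  (fun P : {set U} => inord #|P| : 'I_(#|A|.+1)) xpredT) //=.
apply: eq_bigr => i _.
rewrite -cards_draws -[#|[set _ | _]|]sum1_card big_distrl /=.
have sE (P : {set U}) : P \subset A -> (inord #|P| == i) = (#|P| == i).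
  by move=> /subset_leq_card le; rewrite -val_eqE /= inordK.
apply: congr_big => //= [P|P /andP[PA /eqP <-]].
  by rewrite !inE; case: (boolP (P \subset A)) => // /sE->.
by rewrite mul1n inordK ?ltnS ?subset_leq_card // -?powersetE.
Qed.

Section StableSets.

Variables (T : finType) (s : {perm T}).

Definition fixpoints := [set x | s x == x].
Definition moved_orbits := [set porbit s x | x in ~: fixpoints].

Lemma moved_orbitP O :
  reflect (exists2 x, s x != x & O = porbit s x) (O \in moved_orbits).
Proof.
by apply: (iffP imsetP) => -[x + ->]; rewrite ?inE => sx; exists x; rewrite ?inE.
Qed.

Lemma mem_moved_orbit x O :
  O \in moved_orbits -> x \in O -> O = porbit s x /\ x \notin fixpoints.
Proof.
case/moved_orbitP=> y sy -> /porbitP[i ->]; rewrite porbit_perm.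
split=> //; rewrite inE -permM -expgSr expgS permM.
by rewrite (inj_eq perm_inj).
Qed.

Lemma moved_orbits_trivIset : trivIset moved_orbits.
Proof.
apply/trivIsetP => A B Am Bm; apply: contraR => /pred0Pn[x /andP[/= xA xB]].
by have [-> _] := mem_moved_orbit Am xA; have [-> _] := mem_moved_orbit Bm xB.
Qed.

Lemma cover_moved_orbits : cover moved_orbits = ~: fixpoints.
Proof.
apply/setP=> x; rewrite inE.
apply/bigcupP/idP => [[O Om /(mem_moved_orbit Om)[]]//|xF].
exists (porbit s x); rewrite ?porbit_id //.
by apply/moved_orbitP; exists x; rewrite // inE in xF.
Qed.

Variable d : nat.
Hypothesis card_moved : forall x, s x != x -> #|porbit s x| = d.

Lemma card_cover_moved (Q : {set {set T}}) :
  Q \subset moved_orbits -> #|cover Q| = (d * #|Q|)%N.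
Proof.
move=> QM; have /eqP <- : trivIset Q by apply: trivIsetS moved_orbits_trivIset.
rewrite mulnC -sum_nat_const; apply: eq_bigr => O /(subsetP QM).
by case/moved_orbitP=> x sx ->; apply: card_moved.
Qed.

Lemma cover_moved_notin (Q : {set {set T}}) x :
  Q \subset moved_orbits -> x \in cover Q -> x \notin fixpoints.
Proof.
move=> QM /bigcupP[O /(subsetP QM) OM xO].
by have [] := mem_moved_orbit OM xO.
Qed.

Lemma card_fix_cover (P : {set T}) (Q : {set {set T}}) :
    P \subset fixpoints -> Q \subset moved_orbits ->
  #|P :|: cover Q| = (#|P| + d * #|Q|)%N.
Proof.
move=> PF QM; rewrite cardsU card_cover_moved //.
rewrite [X in (_ - X)%N]eq_card0 ?subn0 // => x; rewrite inE.
apply/negbTE/negP => /andP[/(subsetP PF) xF /(cover_moved_notin QM)].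
by rewrite xF.
Qed.

Lemma card_fix_moved : #|T| = (#|fixpoints| + d * #|moved_orbits|)%N.
Proof. by rewrite -card_cover_moved // cover_moved_orbits cardsC. Qed.

Lemma porbit_sub_stable (B : {set T}) x :
  s @: B = B -> x \in B -> porbit s x \subset B.
Proof.
move=> sB xB; apply/subsetP=> y /porbitP[i ->].
by elim: i => [|i IHi]; rewrite ?perm1 // expgSr permM -sB imset_f.
Qed.

(** A stable set is the union of a set P of fixed points and of a set Q of moved
    orbits, both arbitrary, and it determines them. *)
Lemma card_stable_sets N :
  (#|stable_sets s N| =
   \sum_(i < #|fixpoints|.+1) 'C(#|fixpoints|, i) *
     \sum_(j < #|moved_orbits|.+1)
        'C(#|moved_orbits|, j) * (i + d * j == N))%N.
Proof.
pose D := [set PQ in setX (powerset fixpoints) (powerset moved_orbits)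
  | #|PQ.1| + d * #|PQ.2| == N]%N.
pose h (PQ : {set T} * {set {set T}}) := PQ.1 :|: cover PQ.2.
pose g (B : {set T}) :=
  (B :&: fixpoints, [set O in moved_orbits | O \subset B]).
have hK : {in D, cancel h g}.
  case=> P Q; rewrite inE in_setX !powersetE => /andP[/andP[/= PF QM] _].
  rewrite /g /h /=; congr pair.
    apply/setP=> x; rewrite 2!inE; have [xP|xP] /= := boolP (x \in P).
      exact: (subsetP PF).
    by apply/negbTE/negP => /andP[/(cover_moved_notin QM)/negP].
  apply/setP=> O; rewrite inE; apply/andP/idP => [[OM OB]|OQ].
    have /moved_orbitP[x xF OE] := OM.
    have: x \in P :|: cover Q by apply: (subsetP OB); rewrite OE porbit_id.
    rewrite inE => /orP[/(subsetP PF)|]; first by rewrite inE (negPf xF).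
    case/bigcupP=> O' O'Q xO'.
    by have [E _] := mem_moved_orbit (subsetP QM _ O'Q) xO'; rewrite OE -E.
  split; first exact: (subsetP QM).
  by apply: subsetU; rewrite orbC (bigcup_max O).
transitivity #|h @: D|.
  apply: eq_card => B; apply/idP/imsetP => [|[[P Q]]].
    rewrite inE => /andP[/eqP sB /eqP cB].
    have hB : B = h (g B).
      apply/setP=> x; rewrite /h /g !inE.
      apply/idP/orP => [xB|[/andP[]//|]].
        have [sx|sx] := eqVneq (s x) x; first by left; rewrite xB.
        right; apply/bigcupP; exists (porbit s x); rewrite ?porbit_id // inE.
        by rewrite porbit_sub_stable // andbT; apply/moved_orbitP; exists x.
      by case/bigcupP=> O; rewrite inE => /andP[_ OB]; apply: (subsetP OB).
    exists (g B) => //; rewrite inE in_setX !powersetE /= subsetIr /=.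
    have QM : [set O in moved_orbits | O \subset B] \subset moved_orbits.
      by apply/subsetP=> O; rewrite inE => /andP[].
    by rewrite QM /= -card_fix_cover ?subsetIr // -cB {3}hB.
  rewrite [in X in X -> _]inE in_setX !powersetE.
  move=> /andP[/andP[/= PF QM] /eqP cB] ->; rewrite inE /h /=.
  rewrite card_fix_cover // cB eqxx andbT.
  rewrite eqEcard (card_imset _ perm_inj) leqnn andbT.
  apply/subsetP=> _ /imsetP[x + ->]; rewrite !inE => /orP[xP|].
    by have := subsetP PF _ xP; rewrite inE => /eqP->; rewrite xP.
  case/bigcupP=> O OQ xO; apply/orP; right; apply/bigcupP; exists O => //.
  have [-> _] := mem_moved_orbit (subsetP QM _ OQ) xO.
  by rewrite -{1}[s]expg1 mem_porbit.
rewrite (card_in_imset (can_in_inj hK)) -sum1_card.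
rewrite -(sum_powerset_card _ (fun i => \sum_(j < #|moved_orbits|.+1)
  'C(#|moved_orbits|, j) * (i + d * j == N)))%N.
transitivity (\sum_(P in powerset fixpoints) \sum_(Q in powerset moved_orbits)
  (#|P| + d * #|Q| == N))%N; last first.
  apply: eq_bigr => P _.
  by rewrite (sum_powerset_card _ (fun j => #|P| + d * j == N : nat))%N.
rewrite pair_big /= [RHS]big_mkcond [LHS]big_mkcond; apply: eq_bigr => -[P Q] _.
rewrite /D [(P, Q) \in _]inE in_setX /=.
by do 2![case: (_ \in powerset _) => //=]; case: eqP.
Qed.

End StableSets.

(** * Powers of a Moebius map *)

Section Powers.
Variable F : fieldType.
Implicit Types a b c d t x y : F.

(** The pair (U_k, - U_(k-1)) of coefficients of M^k = U_k M - U_(k-1) for a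
    matrix M of determinant 1 and trace t; the second one makes sense for k = 0
    with U_(-1) = -1. *)
Fixpoint cayley t k : F * F :=
  if k is k'.+1 then let: (u, v) := cayley t k' in (t * u + v, - u) else (0, 1).

(** The Chebyshev polynomials of the second kind, as U_k(t) with U_k(2) = k. *)
Definition cheb t k := (cayley t k).1.

(** The left-hand side is det (u M + v) when M has determinant 1 and trace t. *)
Lemma cayley_norm t k (uv := cayley t k) :
  uv.1 ^+ 2 + t * uv.1 * uv.2 + uv.2 ^+ 2 = 1.
Proof.
rewrite /uv {uv}; elim: k => [|k] /=.
  by rewrite expr0n /= mulr0 mul0r !add0r expr1n.
by case: (cayley t k) => u v /= <-; ring.
Qed.

Lemma iter_moebius a b c d k (z : option F) : a * d - b * c = 1 ->
  let: (u, v) := cayley (a + d) k in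
  iter k (moebius a b c d) z =
    moebius (u * a + v) (u * b) (u * c) (u * d + v) z.
Proof.
move=> D1; elim: k => [|k] /=.
  by rewrite !mul0r !add0r moebius_scalar ?oner_neq0.
have := cayley_norm (a + d) k; case: (cayley _ k) => u v /= N IH.
rewrite {}IH moebius_comp; last first.
  apply/eqP => E; have /eqP := oner_neq0 F; apply.
  by rewrite -E -N -[u ^+ 2]mulr1 -D1; ring.
have uE : - u = - u * (a * d - b * c) by rewrite D1 mulr1.
by congr moebius; [rewrite uE | | | rewrite uE]; ring.
Qed.

Lemma moebius_fixS a b c d y : a * d - b * c != 0 ->
  (moebius a b c d (Some y) == Some y) = (a * y + b == y * (c * y + d)).
Proof.
move=> D0; rewrite /= /Defs.ratio; case: (c * y + d =P 0) => [v0|/eqP v0].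
  rewrite v0 mulr0; transitivity false => //; apply/esym/negbTE.
  apply: contra D0 => /eqP u0.
  have -> : a * d - b * c = a * (c * y + d) - c * (a * y + b) by ring.
  by rewrite u0 v0 !mulr0 subr0.
by rewrite (inj_eq Some_inj) -(inj_eq (mulIf v0)) divfK.
Qed.

Lemma moebius_fixN a b c d :
  (moebius a b c d None == None) = (c == 0).
Proof. by rewrite /= /Defs.ratio; case: (c =P 0). Qed.

(** The fixed points of u M + v are the eigenlines of M, unless u = 0. *)
Lemma iter_moebius_fix a b c d k (z : option F) : a * d - b * c = 1 ->
  (iter k (moebius a b c d) z == z) =
  (cheb (a + d) k == 0) || (moebius a b c d z == z).
Proof.
move=> D1; rewrite /cheb; have := cayley_norm (a + d) k.
have := iter_moebius k z D1.
case: (cayley _ k) => u v /= -> N.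
have [u0|u0] /= := eqVneq u 0.
  rewrite u0 !mul0r !add0r moebius_scalar ?eqxx //; apply/eqP => v0.
  by move/eqP: N; rewrite u0 v0 mulr0 expr0n !addr0 eq_sym oner_eq0.
have D' : (u * a + v) * (u * d + v) - u * b * (u * c) != 0.
  rewrite [X in X != 0](_ : _ = 1) ?oner_neq0 //.
  by rewrite -N -[u ^+ 2]mulr1 -D1; ring.
case: z => [y|]; last by rewrite !moebius_fixN mulf_eq0 (negPf u0).
rewrite !moebius_fixS ?D1 ?oner_neq0 // -subr_eq0 -[RHS]subr_eq0.
rewrite [X in X == 0](_ : _ = u * (a * y + b - y * (c * y + d))); last by ring.
by rewrite mulf_eq0 (negPf u0).
Qed.

End Powers.

(** * Orders and fixed points of elements of SL(2, F) *)

Section Order.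
Variable F : finFieldType.
Implicit Types a b c d t y : F.

Definition eigenvalues t := [set y : F | y ^+ 2 - t * y + 1 == 0].

Lemma eigenvaluesE t y : y \in eigenvalues t -> eigenvalues t = [set y; t - y].
Proof.
rewrite inE => /eqP yE; apply/setP => z; rewrite !inE.
rewrite -[z == y]subr_eq0 -[z == t - y]subr_eq0 -mulf_eq0.
rewrite -[X in X == 0]subr0 -{1}yE.
by congr (_ == 0); ring.
Qed.

Lemma card_fix_option (s : {perm option F}) :
  #|fixpoints s| = ((s None == None) + #|[set x | s (Some x) == Some x]|)%N.
Proof.
rewrite (cardsD1 None) inE; congr (_ + _)%N.
rewrite -(card_imset [set x | s (Some x) == Some x] Some_inj).
apply: eq_card => -[x|]; rewrite !inE /=.
  by rewrite (mem_imset _ _ Some_inj) inE.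
by apply/esym/negbTE/negP => /imsetP[].
Qed.

Variables (a b c d : F) (s : {perm option F}).
Hypothesis D1 : a * d - b * c = 1.
Hypothesis sE : s =1 moebius a b c d.

Lemma perm_exp_fix k x :
  ((s ^+ k)%g x == x) = (cheb (a + d) k == 0) || (s x == x).
Proof. by rewrite permX sE -iter_moebius_fix // (eq_iter sE). Qed.

Lemma perm_neq1 : s != 1%g -> exists x, s x != x.
Proof.
move=> s1; apply/existsP; apply: contraR s1; rewrite negb_exists => /forallP h.
by apply/eqP/permP => x; rewrite perm1; apply/eqP; rewrite -[_ == _]negbK.
Qed.

Lemma order_dvd_cheb k :
  s != 1%g -> (#[s]%g %| k)%N = (cheb (a + d) k == 0).
Proof.
move=> s1; rewrite order_dvdn; apply/eqP/idP => [sk|U0].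
  have [x sx] := perm_neq1 s1.
  by have := perm_exp_fix k x; rewrite sk perm1 eqxx (negPf sx) orbF.
by apply/permP=> x; apply/eqP; rewrite perm1 perm_exp_fix U0.
Qed.

(** If s^k fixes a point that s moves, then U_k = 0, and s^k = 1. *)
Lemma card_porbit_moved x : s x != x -> #|porbit s x| = #[s]%g.
Proof.
move=> sx; have s1 : s != 1%g by apply: contraNneq sx => ->; rewrite perm1.
apply/eqP; rewrite eqn_leq; apply/andP; split.
  by rewrite porbit.unlock; apply: leq_imset_card.
apply: dvdn_leq; first by apply/card_gt0P; exists x; apply: porbit_id.
rewrite order_dvd_cheb //; have := perm_exp_fix #|porbit s x| x.
by rewrite permX iter_porbit eqxx (negPf sx) orbF.
Qed.

(** For c <> 0 infinity is moved and x is fixed exactly when c x + d is an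
    eigenvalue.  For c = 0 infinity is fixed, the eigenvalues are a and d, and
    there is a second fixed point exactly when they differ. *)
Lemma card_fix_eigen : s != 1%g -> #|fixpoints s| = #|eigenvalues (a + d)|.
Proof.
move=> s1; have D0 : a * d - b * c != 0 by rewrite D1 oner_neq0.
rewrite card_fix_option sE moebius_fixN.
have -> : [set x | s (Some x) == Some x] =
          [set x | a * x + b == x * (c * x + d)].
  by apply/setP=> x; rewrite !inE sE moebius_fixS.
have [c0|c0] := eqVneq c 0; last first.
  rewrite add0n -(card_imset _ (_ : injective (fun x => c * x + d))); last first.
    by move=> x y /addIr /(mulfI c0).
  apply: eq_card => z; rewrite inE; apply/imsetP/idP.
    case=> x; rewrite inE -subr_eq0 => /eqP E ->.
    apply/eqP; transitivity (- c * (a * x + b - x * (c * x + d))).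
      by rewrite -D1; ring.
    by rewrite E mulr0.
  move=> zE; exists ((z - d) / c); last by rewrite mulrC divfK ?subrK.
  rewrite inE [c * _]mulrC divfK // subrK -subr_eq0 -(mulrI_eq0 _ (mulfI c0)).
  rewrite (_ : _ * _ = - (z ^+ 2 - (a + d) * z + 1)) ?oppr_eq0 //.
  by rewrite -D1; field.
move: D1 sE; rewrite c0 mulr0 subr0 => ad1 sE'.
have a0 : a != 0.
  by apply/eqP => E; move/eqP: ad1; rewrite E mul0r eq_sym oner_eq0.
have -> : eigenvalues (a + d) = [set a; d].
  have aE : a \in eigenvalues (a + d) by rewrite inE -ad1; apply/eqP; ring.
  by rewrite (eigenvaluesE aE) addrAC subrr add0r.
have -> : [set x | a * x + b == x * (0 * x + d)] = [set x | (a - d) * x == - b].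
  apply/setP=> x; rewrite !inE -subr_eq0 -[RHS]subr_eq0.
  by congr (_ == 0); ring.
have [aE|ad] := eqVneq a d.
  rewrite -aE setUid cards1 eq_card0 // => x.
  rewrite !inE subrr mul0r eq_sym oppr_eq0.
  apply: contraNF s1 => /eqP b0; apply/eqP/permP => y.
  by rewrite perm1 sE' -aE b0 moebius_scalar.
rewrite cards2 ad (_ : [set x | _] = [set (- b) / (a - d)]) ?cards1 //.
have ad0 : a - d != 0 by rewrite subr_eq0.
by apply/setP=> x; rewrite !inE (can2_eq (mulKf ad0) (mulVKf ad0)) mulrC.
Qed.

End Order.

(** * The polynomials psi_k in characteristic 2 *)

Section Psi.
Variable F : fieldType.
Hypothesis two0 : 2 = 0 :> F.
Implicit Types t x y : F.

(** This reduces an identity of characteristic 2 to one that [ring] proves,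
    given half of the difference of its sides. *)
Lemma eq_char2 x y z : x - y = 2 * z -> x = y.
Proof. by rewrite two0 mul0r => /eqP; rewrite subr_eq0 => /eqP. Qed.

(** With t = y + 1/y one has U_k(t) = (y^k - y^(-k)) / (y - 1/y); the roots of
    psi_k are the traces of the nontrivial elements of order dividing 2k + 1. *)
Definition psi k t := cheb t k.+1 + cheb t k.

Lemma cheb_rec t k : cheb t k.+2 = t * cheb t k.+1 - cheb t k.
Proof. by rewrite /cheb /=; case: (cayley t k). Qed.

Lemma cheb_double t k :
  cheb t (k.*2.+1) = cheb t k.+1 ^+ 2 - cheb t k ^+ 2 /\
  cheb t (k.*2.+2) = cheb t k.+1 * (t * cheb t k.+1 - 2 * cheb t k).
Proof.
elim: k => [|k [IH1 IH2]]; first by rewrite /cheb /=; split; ring.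
rewrite doubleS (cheb_rec t k.*2.+2) (cheb_rec t k.*2.+1) (cheb_rec t k) IH1 IH2.
by split; ring.
Qed.

(** In characteristic 2, U_(2k+1) is the square of psi_k. *)
Lemma cheb_psi t k : (cheb t k.*2.+1 == 0) = (psi k t == 0).
Proof.
have [-> _] := cheb_double t k; rewrite subr_sqr mulf_eq0 orbC.
rewrite -/(psi k t); have [//|] := eqVneq (psi k t) 0.
rewrite (_ : cheb t k.+1 - cheb t k = psi k t) => [/negPf->//|].
by apply: (@eq_char2 _ _ (- cheb t k)); rewrite /psi; ring.
Qed.

Lemma psi_at0 k : psi k 0 = 1.
Proof.
elim: k => [|k IHk]; first by rewrite /psi /cheb /=; ring.
rewrite -[RHS]IHk; apply: (@eq_char2 _ _ (- cheb 0 k)).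
by rewrite /psi cheb_rec; ring.
Qed.

Lemma psi1E t : psi 1 t = t + 1.
Proof. by rewrite /psi /cheb /=; ring. Qed.

Lemma psi5E t : psi 5 t = t ^+ 5 + t ^+ 4 + t ^+ 2 + t + 1.
Proof.
apply: (@eq_char2 _ _ (- 2 * t ^+ 3 - 2 * t ^+ 2 + t)).
by rewrite /psi /cheb /=; ring.
Qed.

Lemma psi6E t : psi 6 t = t ^+ 6 + t ^+ 5 + t ^+ 4 + t + 1.
Proof.
apply: (@eq_char2 _ _ (- 3 * t ^+ 4 - 2 * t ^+ 3 + 3 * t ^+ 2 + t - 1)).
by rewrite /psi /cheb /=; ring.
Qed.

(** One squaring in the computation of a power modulo P: the remainder r of p is
    squared and reduced to r', with quotient q. *)
Lemma dvdp_sqr_step (R : idomainType) (P p r r' q s : {poly R}) : 2 = 0 :> R ->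
  P %| p - r -> r ^+ 2 - r' = P * q + 2 * s -> P %| p ^+ 2 - r'.
Proof.
move=> R2 Ppr E; have -> : p ^+ 2 - r' = (p - r) * (p + r) + (r ^+ 2 - r').
  by ring.
have P2 : 2 = 0 :> {poly R} by rewrite -[2]/(2%:R) -polyC_natr R2.
by rewrite E P2 mul0r addr0 dvdp_add ?dvdp_mulr.
Qed.

Definition psi_poly5 : {poly F} := 'X^5 + 'X^4 + 'X^2 + 'X + 1.
Definition psi_poly6 : {poly F} := 'X^6 + 'X^5 + 'X^4 + 'X + 1.

(** The remainders of X^8, X^16 and X^32 are found by successive squarings. *)
Lemma psi_poly5_dvd : psi_poly5 %| 'X^(2 ^ 5) - 'X.
Proof.
pose x : {poly F} := 'X.
have h4 : psi_poly5 %| x ^+ 4 - x ^+ 4 by rewrite subrr dvdp0.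
have h8 : psi_poly5 %| (x ^+ 4) ^+ 2 - (x ^+ 3 + x).
  apply: (@dvdp_sqr_step _ _ _ _ _ (x ^+ 3 + x ^+ 2 + x)
   (- x ^+ 7 - x ^+ 6 - x ^+ 5 - x ^+ 4 - 2 * x ^+ 3 - x ^+ 2 - x) two0 h4).
  by rewrite /psi_poly5 -/x; ring.
have h16 : psi_poly5 %| ((x ^+ 4) ^+ 2) ^+ 2 - (x ^+ 4 + x ^+ 3 + x ^+ 2 + 1).
  apply: (@dvdp_sqr_step _ _ _ _ _ (x + 1)
   (- x ^+ 5 - x ^+ 3 - x ^+ 2 - x - 1) two0 h8).
  by rewrite /psi_poly5 -/x; ring.
have := @dvdp_sqr_step _ _ _ _ x (x ^+ 3 + x ^+ 2 + 1) (x ^+ 6 - x) two0 h16.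
by rewrite -!exprM; apply; rewrite /psi_poly5 -/x; ring.
Qed.

Lemma psi_poly6_dvd : psi_poly6 %| 'X^(2 ^ 6) - 'X.
Proof.
pose x : {poly F} := 'X.
have h4 : psi_poly6 %| x ^+ 4 - x ^+ 4 by rewrite subrr dvdp0.
have h8 : psi_poly6 %| (x ^+ 4) ^+ 2 - (x ^+ 5 + x ^+ 3 + x).
  apply: (@dvdp_sqr_step _ _ _ _ _ (x ^+ 2 + x)
   (- x ^+ 7 - x ^+ 6 - x ^+ 5 - x ^+ 3 - x ^+ 2 - x) two0 h4).
  by rewrite /psi_poly6 -/x; ring.
have h16 : psi_poly6 %| ((x ^+ 4) ^+ 2) ^+ 2 - (x ^+ 3 + x).
  apply: (@dvdp_sqr_step _ _ _ _ _ (x ^+ 4 + x ^+ 3 + x)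
   (- x ^+ 9 - x ^+ 7 + x ^+ 6 - x ^+ 5 - x ^+ 3 - x) two0 h8).
  by rewrite /psi_poly6 -/x; ring.
have h32 : psi_poly6 %|
    (((x ^+ 4) ^+ 2) ^+ 2) ^+ 2 - (x ^+ 5 + x ^+ 4 + x ^+ 2 + x + 1).
  apply: (@dvdp_sqr_step _ _ _ _ _ 1 (- x ^+ 5 - x - 1) two0 h16).
  by rewrite /psi_poly6 -/x; ring.
have := @dvdp_sqr_step _ _ _ _ x (x ^+ 4 + x ^+ 3 + x ^+ 2 + 1)
  (- x ^+ 8 + x ^+ 6 + x ^+ 5 + x ^+ 2) two0 h32.
by rewrite -!exprM; apply; rewrite /psi_poly6 -/x; ring.
Qed.

Lemma dvdp_XpowX (P : {poly F}) N k : P %| 'X^N - 'X -> P %| 'X^(N ^ k) - 'X.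
Proof.
move=> PN; elim: k => [|k IHk]; first by rewrite expn0 subrr dvdp0.
rewrite -(subrKA 'X^N) dvdp_add // expnSr exprM.
by rewrite subrXX dvdp_mulr.
Qed.

End Psi.

Lemma card_roots_dvd (F : finFieldType) (P : {poly F}) :
  P %| 'X^#|F| - 'X -> #|[set x | root P x]| = (size P).-1.
Proof.
rewrite finField_genPoly => /dvdp_prod_XsubC[m /[dup] Pm /eqp_size ->].
rewrite size_prod_XsubC /= -(card_uniqP _); last first.
  by rewrite mask_uniq // /index_enum -enumT enum_uniq.
by apply: eq_card => x; rewrite inE (eqp_root Pm) root_prod_XsubC.
Qed.

(** * Counting the matrices of SL(2, F) by their trace *)

Lemma card_set_pair (T U : finType) (P : pred (T * U)) :
  #|[set p | P p]| = (\sum_x #|[set y | P (x, y)]|)%N.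
Proof.
rewrite -sum1_card (eq_bigl P) => [|p]; last by rewrite inE.
rewrite (eq_bigl (fun p => xpredT p.1 && P (p.1, p.2))); last by case.
rewrite -(pair_big_dep xpredT (fun x y => P (x, y)) (fun _ _ => 1%N)) /=.
by apply: eq_bigr => x _; rewrite -sum1_card; apply: eq_bigl => y; rewrite inE.
Qed.

Section SL2.
Variable F : finFieldType.
Implicit Types t x y : F.

Definition mat2 := (F * F * F * F)%type.
Definition sl2 : {set mat2} :=
  [set M | let: (a, b, c, d) := M in a * d - b * c == 1].
Definition tr2 (M : mat2) : F := let: (a, b, c, d) := M in a + d.
(** The identity stands in for the matrices of determinant 0, whose Moebius map
    is not a permutation. *)
Definition moebius_perm (M : mat2) : {perm option F} :=
  let: (a, b, c, d) := M in
  insubd (1%g : {perm option F}) [ffun z => moebius a b c d z].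

Definition id2 : mat2 := (1, 0, 0, 1).

Lemma moebius_permE a b c d : a * d - b * c != 0 ->
  moebius_perm (a, b, c, d) =1 moebius a b c d.
Proof.
move=> D0 z; rewrite /moebius_perm -pvalE insubdK ?ffunE //.
by apply/injectiveP => x y; rewrite !ffunE; apply: moebius_inj.
Qed.

Lemma sl2P a b c d : (a, b, c, d) \in sl2 -> a * d - b * c = 1.
Proof. by rewrite inE => /eqP. Qed.

Lemma sl2_moebius_permE a b c d : (a, b, c, d) \in sl2 ->
  moebius_perm (a, b, c, d) =1 moebius a b c d.
Proof. by move/sl2P=> D1; apply: moebius_permE; rewrite D1 oner_neq0. Qed.

Lemma card_mul_eq e :
  #|[set p : F * F | p.1 * p.2 == e]| = (#|F|.-1 + #|F| * (e == 0%R))%N.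
Proof.
rewrite card_set_pair (bigD1 0) //= addnC; congr (_ + _)%N.
  rewrite -(cardC1 (0 : F)) -sum1_card; apply: eq_bigr => x x0.
  rewrite (_ : [set y | _] = [set x^-1 * e]) ?cards1 //.
  by apply/setP=> y; rewrite !inE (can2_eq (mulKf x0) (mulVKf x0)).
have [->|e0] := eqVneq e 0.
  by rewrite muln1; apply: eq_card => y; rewrite !inE mul0r eqxx.
by rewrite muln0 eq_card0 // => y; rewrite !inE mul0r eq_sym (negPf e0).
Qed.

(** With d = t - a, the product b c must be a (t - a) - 1, which vanishes
    exactly when a is an eigenvalue. *)
Lemma card_sl2_trace t :
  #|[set M in sl2 | tr2 M == t]| = (#|F| * (#|F|.-1 + #|eigenvalues t|))%N.
Proof.
pose h (p : F * (F * F)) : mat2 := (p.1, p.2.1, p.2.2, t - p.1).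
have h_inj : injective h by move=> [a [b c]] [a' [b' c']] [-> -> ->].
transitivity #|[set p : F * (F * F) | p.2.1 * p.2.2 == p.1 * (t - p.1) - 1]|.
  rewrite -(card_imset _ h_inj); apply: eq_card => -[[[a b] c] d].
  rewrite !inE; apply/andP/imsetP => [[/eqP D1 /eqP tE]|[[a' [b' c']]]].
    exists (a, (b, c)); last by rewrite /h /= -tE addrAC subrr add0r.
    by rewrite inE /= -D1 -tE /tr2; apply/eqP; ring.
  rewrite inE /h /= => /eqP E [-> -> -> ->]; rewrite E /tr2; split; apply/eqP; ring.
rewrite card_set_pair /=.
under eq_bigr do rewrite card_mul_eq.
rewrite big_split /= sum_nat_const -big_distrr /= mulnDr; congr (_ + _ * _)%N.
rewrite -sum1_card big_mkcond [RHS]big_mkcond /=; apply: eq_bigr => a _.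
rewrite inE -oppr_eq0.
rewrite (_ : - (a * (t - a) - 1) = a ^+ 2 - t * a + 1); last by ring.
by case: eqP.
Qed.

(** Each y <> 0 is an eigenvalue for the single trace y + 1/y. *)
Lemma sum_card_eigenvalues : (\sum_(t : F) #|eigenvalues t| = #|F|.-1)%N.
Proof.
transitivity (\sum_(y : F) #|[set t | y \in eigenvalues t]|)%N.
  under eq_bigr do rewrite -sum1_card big_mkcond.
  rewrite exchange_big /=; apply: eq_bigr => y _.
  rewrite -sum1_card [RHS]big_mkcond /=; apply: eq_bigr => t _.
  by rewrite [t \in _]inE.
rewrite (bigD1 0) //= eq_card0 ?add0n => [|t]; last first.
  by rewrite !inE expr0n mulr0 subrr add0r oner_eq0.
rewrite -(cardC1 (0 : F)) -sum1_card; apply: eq_bigr => y y0.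
rewrite (_ : [set t | _] = [set (y ^+ 2 + 1) / y]) ?cards1 //.
apply/setP=> t; rewrite !inE -[RHS](can2_eq (mulfK y0) (mulfVK y0)).
by rewrite -[RHS]subr_eq0 -[LHS]oppr_eq0; congr (_ == 0); ring.
Qed.

Lemma card_sl2 : #|sl2| = (#|F| * (#|F|.-1 * #|F|.+1))%N.
Proof.
transitivity (\sum_t #|[set M in sl2 | tr2 M == t]|)%N.
  rewrite -sum1_card (partition_big tr2 xpredT) //=.
  by apply: eq_bigr => t _; rewrite -sum1_card; apply: eq_bigl => M; rewrite inE.
under eq_bigr do rewrite card_sl2_trace mulnDr.
rewrite big_split /= sum_nat_const -big_distrr /= sum_card_eigenvalues.
by rewrite -mulnDr; congr (_ * _)%N; rewrite mulnS addnC [(_.-1 * _)%N]mulnC.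
Qed.

End SL2.

(** * PSL(2, F) in characteristic 2 *)

Section CharTwo.
Variable F : finFieldType.
Hypothesis two0 : 2 = 0 :> F.
Implicit Types t x y : F.

Lemma sqr_eq1_char2 x : x ^+ 2 = 1 -> x = 1.
Proof.
move=> x2; apply/eqP; rewrite -subr_eq0 -sqrf_eq0; apply/eqP.
by apply: (@eq_char2 _ two0 _ _ (1 - x)); rewrite sqrrB x2; ring.
Qed.

Lemma sl2_moebius_trivial (a b c d : F) : a * d - b * c = 1 ->
  moebius a b c d =1 id -> [/\ a = 1, b = 0, c = 0 & d = 1].
Proof.
move=> D1 E; have D0 : a * d - b * c != 0 by rewrite D1 oner_neq0.
have /eqP := E None; rewrite moebius_fixN => /eqP c0.
have /eqP := E (Some 0); rewrite moebius_fixS // => /eqP.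
rewrite mulr0 mul0r add0r => b0.
have /eqP := E (Some 1); rewrite moebius_fixS // => /eqP.
rewrite b0 c0 !mulr1 mul1r addr0 add0r => ad.
have a1 : a = 1 by apply: sqr_eq1_char2; rewrite -D1 b0 ad; ring.
by split=> //; rewrite -ad.
Qed.

(** The map of M'^(-1) M is trivial, and the only scalar of determinant 1 is the
    identity. *)
Lemma moebius_perm_inj : {in sl2 F &, injective (@moebius_perm F)}.
Proof.
move=> [[[a b] c] d] [[[a' b'] c'] d'] MS MS' E.
have D1 := sl2P MS; have D1' := sl2P MS'.
have [] := @sl2_moebius_trivial (d' * a - b' * c) (d' * b - b' * d)
  (- c' * a + a' * c) (- c' * b + a' * d).
- by rewrite -[RHS]mulr1 -{1}D1 -D1'; ring.
- move=> z; rewrite -!mulNr -moebius_comp ?D1 ?oner_neq0 //.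
  rewrite -(sl2_moebius_permE MS) E (sl2_moebius_permE MS').
  rewrite moebius_comp ?D1' ?oner_neq0 // -[RHS](@moebius_scalar _ 1) ?oner_neq0 //.
  by congr moebius; rewrite -?D1'; ring.
move=> e1 e2 e3 e4.
have -> : a = a'.
  transitivity (a' * (d' * a - b' * c) + b' * (- c' * a + a' * c)).
    by rewrite -[LHS]mulr1 -D1'; ring.
  by rewrite e1 e3; ring.
have -> : b = b'.
  transitivity (a' * (d' * b - b' * d) + b' * (- c' * b + a' * d)).
    by rewrite -[LHS]mulr1 -D1'; ring.
  by rewrite e2 e4; ring.
have -> : c = c'.
  transitivity (c' * (d' * a - b' * c) + d' * (- c' * a + a' * c)).
    by rewrite -[LHS]mulr1 -D1'; ring.
  by rewrite e1 e3; ring.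
have -> // : d = d'.
transitivity (c' * (d' * b - b' * d) + d' * (- c' * b + a' * d)).
  by rewrite -[LHS]mulr1 -D1'; ring.
by rewrite e2 e4; ring.
Qed.

Variable n : nat.
Hypothesis n_gt0 : (0 < n)%N.
Hypothesis cardF : #|F| = (2 ^ n)%N.

(** Every element of F is a square, so any invertible matrix can be scaled to
    determinant 1. *)
Lemma PSL2_sl2 : PSL2 F = @moebius_perm F @: sl2 F.
Proof.
apply/setP=> s; apply/PSL2P/imsetP; last first.
  case=> -[[[a b] c] d] MS ->; exists a, b, c, d.
  split; last exact: sl2_moebius_permE.
  by rewrite (sl2P MS) oner_neq0.
case=> a [b [c [d [D0 sE]]]].
(* The square root of x is x^(q/2). *)
pose k := (a * d - b * c)^-1 ^+ (2 ^ n.-1).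
have k2 : k ^+ 2 = (a * d - b * c)^-1.
  by rewrite -exprM -expnSr prednK // -cardF expf_card.
have k0 : k != 0 by rewrite -sqrf_eq0 k2 invr_eq0.
have MS : (k * a, k * b, k * c, k * d) \in sl2 F.
  by rewrite inE -(mulVf D0) -k2; apply/eqP; ring.
exists (k * a, k * b, k * c, k * d) => //; apply/permP => z.
rewrite sE sl2_moebius_permE // -[LHS](moebius_scalar _ k0).
by rewrite moebius_comp //; congr moebius; ring.
Qed.

Lemma card_eigenvalues_char2 t : t != 0 ->
  #|eigenvalues t| = 0%N \/ #|eigenvalues t| = 2%N.
Proof.
move=> t0; have [->|[y yE]] := set_0Vmem (eigenvalues t); first by left; rewrite cards0.
right; rewrite (eigenvaluesE yE) cards2; case: eqP => // E; case/eqP: t0.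
by apply: (@eq_char2 _ two0 _ _ y); rewrite subr0 -[LHS](subrK y) -E; ring.
Qed.

Lemma card_eigenvalues0 : #|eigenvalues (0 : F)| = 1%N.
Proof.
have yE : 1 \in eigenvalues (0 : F).
  by rewrite inE mul0r subr0 expr1n -[1 + 1]/2 two0.
rewrite (eigenvaluesE yE) (_ : 0 - 1 = 1 :> F) ?setUid ?cards1 //.
by apply: (@eq_char2 _ two0 _ _ (- 1)); ring.
Qed.

End CharTwo.

(** * Burnside's lemma, sorted by the trace *)

Lemma sum_bin_weight d m i N : (0 < d)%N ->
  (\sum_(j < m.+1) 'C(m, j) * (i + d * j == N) =
   if (i <= N) && (d %| N - i) then 'C(m, (N - i) %/ d) else 0)%N.
Proof.
move=> d0; case: ifP => [/andP[iN /dvdnP[j0 E]]|H]; last first.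
  rewrite big1 // => j _; case: eqP => [E|]; last by rewrite muln0.
  by move/negP: H; case; rewrite -E leq_addr addKn dvdn_mulr.
have P j : (i + d * j == N)%N = (j == j0).
  by rewrite -[RHS](eqn_pmul2l d0) -[RHS](eqn_add2l i) [(d * j0)%N]mulnC -E subnKC.
rewrite E mulnK //; under eq_bigr do rewrite P.
have [jm|mj] := ltnP j0 m.+1; last first.
  rewrite bin_small // big1 // => j _; case: eqP => [E'|]; last by rewrite muln0.
  by move: (ltn_ord j); rewrite E' ltnNge mj.
rewrite (bigD1 (Ordinal jm)) //= eqxx muln1 big1 ?addn0 // => j.
by rewrite -val_eqE /= => /negPf->; rewrite muln0.
Qed.

Section Burnside.
Variable F : finFieldType.
Hypothesis two0 : 2 = 0 :> F.
Variable n : nat.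
Hypothesis n_gt0 : (0 < n)%N.
Hypothesis cardF : #|F| = (2 ^ n)%N.
Implicit Types t x y : F.

Lemma N13_burnside :
  (N13 F * #|sl2 F| = \sum_(M in sl2 F) #|stable_sets (moebius_perm M) 13|)%N.
Proof.
have inj := moebius_perm_inj two0; have PE := PSL2_sl2 n_gt0 cardF.
rewrite -(card_in_imset inj) -PE /N13 -(@Frobenius_Cauchy _ _ _ _ (PSL2_group F)).
  rewrite /= PE big_imset //=; apply: eq_bigr => M _; apply: eq_card => B.
  by rewrite !inE sub1set inE andbC.
by apply/actsP => s _ B; rewrite !inE; congr (_ == _); apply: card_imset perm_inj.
Qed.

Lemma sum_sl2_trace (f : mat2 F -> nat) :
  (\sum_(M in sl2 F) f M = \sum_t \sum_(M in [set M in sl2 F | tr2 M == t]) f M)%N.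
Proof.
rewrite (partition_big (@tr2 F) xpredT) //=; apply: eq_bigr => t _.
by apply: eq_bigl => M; rewrite [RHS]inE.
Qed.

Lemma card_line : #|{: option F}| = #|F|.+1.
Proof. exact: card_option. Qed.

(** The number m is that of the nontrivial orbits. *)
Lemma moebius_stable_sets (M : mat2 F)
    (s := moebius_perm M) (r := #|eigenvalues (tr2 M)|) :
  M \in sl2 F -> s != 1%g ->
  exists m, #|F|.+1 = (r + #[s]%g * m)%N /\
  #|stable_sets s 13| = (\sum_(i < r.+1) 'C(r, i) *
     if (i <= 13) && (#[s]%g %| 13 - i) then 'C(m, (13 - i) %/ #[s]%g)
     else 0)%N.
Proof.
rewrite /s /r; case: M {s r} => [[[a b] c] d] MS; set s := moebius_perm _ => s1.
have D1 := sl2P MS; have sE : s =1 _ := sl2_moebius_permE MS.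
have fE := card_fix_eigen D1 sE s1; have pE := card_porbit_moved D1 sE.
rewrite /tr2 -fE; exists #|moved_orbits s|; split.
  by rewrite -card_line; apply: card_fix_moved.
rewrite (card_stable_sets pE); apply: eq_bigr => i _.
by rewrite sum_bin_weight // order_gt0.
Qed.

Lemma moebius_order_dvd (M : mat2 F) k : M \in sl2 F -> moebius_perm M != 1%g ->
  (#[moebius_perm M]%g %| k)%N = (cheb (tr2 M) k == 0).
Proof.
case: M => [[[a b] c] d] MS s1.
exact: (order_dvd_cheb (sl2P MS) (sl2_moebius_permE MS) _ s1).
Qed.

Lemma sl2_1 : id2 F \in sl2 F.
Proof. by rewrite inE /id2 mulr1 mulr0 subr0. Qed.

Lemma moebius_perm1 : moebius_perm (id2 F) = 1%g.
Proof.
apply/permP => z; rewrite /id2 (sl2_moebius_permE sl2_1) perm1 moebius_scalar //.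
exact: oner_neq0.
Qed.

Lemma moebius_perm_neq1 (M : mat2 F) : M \in sl2 F -> M != id2 F ->
  moebius_perm M != 1%g.
Proof.
move=> MS; apply: contra_neq => E; apply: (moebius_perm_inj two0) => //.
  exact: sl2_1.
by rewrite moebius_perm1.
Qed.

Lemma tr2_1 : tr2 (id2 F) = 0 :> F.
Proof. by rewrite /tr2 /id2 -[RHS]two0. Qed.

(** An involution has one fixed point, so it pairs off the q other points, and a
    stable 13-subset is the fixed point with 6 of the q / 2 pairs. *)
Lemma involution_stable_sets (M : mat2 F) : M \in sl2 F -> M != id2 F ->
  tr2 M = 0 -> #|stable_sets (moebius_perm M) 13| = 'C(2 ^ n.-1, 6).
Proof.
move=> MS M1 M0; have s1 := moebius_perm_neq1 MS M1.
have [m []] := moebius_stable_sets MS s1; rewrite M0 (card_eigenvalues0 two0).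
have -> : #[moebius_perm M]%g = 2%N.
  apply/prime_nt_dvdP; rewrite ?order_eq1 //.
  by rewrite moebius_order_dvd // M0 /cheb /= !mul0r add0r oppr0.
rewrite cardF -[in LHS](prednK n_gt0) expnS add1n => -[/eqP].
rewrite eqn_pmul2l // => /eqP <- ->.
by rewrite !big_ord_recl big_ord0 /= muln0 addn0 mul1n.
Qed.

Lemma sum_trace0 :
  (\sum_(M in [set M in sl2 F | tr2 M == 0%R])
     #|stable_sets (moebius_perm M) 13| =
   'C(#|F|.+1, 13) + (#|F|.-1 * #|F|.+1) * 'C(2 ^ n.-1, 6))%N.
Proof.
have I : id2 F \in [set M in sl2 F | tr2 M == 0].
  by rewrite [_ \in _]inE sl2_1 tr2_1 eqxx.
rewrite (big_setD1 _ I) moebius_perm1; congr (_ + _)%N.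
  rewrite -card_line -card_draws; apply: eq_card => B; rewrite !inE.
  by rewrite (eq_imset _ (@perm1 _)) imset_id eqxx.
rewrite (eq_bigr (fun _ => 'C(2 ^ n.-1, 6))) => [|M]; last first.
  rewrite in_setD1 => /andP[M1]; rewrite [_ \in _]inE => /andP[MS /eqP M0].
  exact: involution_stable_sets.
rewrite sum_nat_const; congr (_ * _)%N.
have := card_sl2_trace (0 : F).
rewrite [in X in X -> _](cardsD1 (id2 F)) I (card_eigenvalues0 two0).
have : (0 < #|F|)%N by rewrite cardF expn_gt0.
by case: #|F| => // q _ /=; lia.
Qed.

(** For r = 2 the terms i = 0, 1, 2 need d to divide 13, 12 or 11.  The only odd
    divisor d > 1 of 12 is 3; it needs i = 1, one of the two fixed points. *)
Lemma odd_weight_value d m r : odd d -> (1 < d)%N -> r = 0%N \/ r = 2%N ->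
  (\sum_(i < r.+1) 'C(r, i) *
     (if (i <= 13) && (d %| 13 - i) then 'C(m, (13 - i) %/ d) else 0) =
   (d == 13) * m + (r == 2) * ((d == 11) * m + (d == 3) * (2 * 'C(m, 4))))%N.
Proof.
move=> od d1 r02; have [dbig|] := ltnP 13 d.
  have ndv k : (0 < k <= 13)%N -> (d %| k)%N = false.
    by move=> /andP[k0 k13]; apply/negbTE/negP => /(dvdn_leq k0); lia.
  have -> : (d == 13)%N = false by lia.
  have -> : (d == 11)%N = false by lia.
  have -> : (d == 3)%N = false by lia.
  by case: r02 => ->; rewrite !big_ord_recl big_ord0 /= ?subn0 ?ndv //= !muln0.
have e3 : ((13 - bump 0 0) %/ 3 = 4)%N by [].
have e11 : 'C(2, bump 0 (bump 0 0)) = 1%N by [].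
move: od d1; do 14?[case: d => [|d] //]; case: r02 => -> _ _ _;
  by rewrite !big_ord_recl big_ord0 /= ?e3 ?e11 ?bin1 ?bin0; lia.
Qed.

(** The order of an element is a function of its trace t <> 0, as are its
    numbers of fixed points and of orbits; so it may be taken from a companion
    matrix.  It is odd because q + 1 - r is odd. *)
Lemma order_of_trace t (r := #|eigenvalues t|) : t != 0 ->
  exists d m, [/\ (1 < d)%N, #|F|.+1 = (r + d * m)%N,
    forall k, (d %| k)%N = (cheb t k == 0)
  & forall M, M \in sl2 F -> tr2 M = t ->
      #|stable_sets (moebius_perm M) 13| = ((d == 13) * m +
        (r == 2) * ((d == 11) * m + (d == 3) * (2 * 'C(m, 4))))%N].
Proof.
rewrite /r => t0 {r}.
have neq1 M : M \in sl2 F -> tr2 M = t -> moebius_perm M != 1%g.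
  move=> MS Mt; apply: moebius_perm_neq1 => //; apply: contraNneq t0 => ME.
  by rewrite -Mt ME tr2_1.
pose C : mat2 F := (t, 1, - 1, 0).
have CS : C \in sl2 F by rewrite inE /C mulr0 mul1r opprK add0r.
have Ct : tr2 C = t by rewrite /tr2 /C addr0.
have s1 := neq1 _ CS Ct.
have [m [qE _]] := moebius_stable_sets CS s1; rewrite Ct in qE.
have dE k : (#[moebius_perm C]%g %| k)%N = (cheb t k == 0).
  by rewrite moebius_order_dvd // Ct.
have d1 : (1 < #[moebius_perm C]%g)%N.
  by rewrite ltn_neqAle eq_sym order_eq1 s1 order_gt0.
move: #[moebius_perm C]%g qE dE d1 => d qE dE d1.
have r02 := card_eigenvalues_char2 two0 t0.
have od : odd d.
  have : odd (#|F|.+1) by rewrite cardF /= oddX orbF -lt0n n_gt0.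
  by rewrite qE oddD oddM; case: r02 => -> /andP[].
exists d, m; split=> // M MS Mt.
have sM := neq1 _ MS Mt.
have [m' [qE' ->]] := moebius_stable_sets MS sM.
have dE' k := moebius_order_dvd k MS sM; rewrite Mt in qE' dE' *.
have dd : #[moebius_perm M]%g = d.
  by apply/eqP; rewrite eqn_dvd dE' -dE dvdnn dE -dE' dvdnn.
rewrite dd in qE' *; move: qE'; rewrite qE => /eqP.
by rewrite eqn_add2l eqn_pmul2l ?(ltnW d1) // => /eqP <-; apply: odd_weight_value.
Qed.

End Burnside.

(** * The number of orbits in terms of the traces *)

(** For q < k both sides are 0, the product through its factor i = q. *)
Lemma natr_ffact (q k : nat) :
  (q ^_ k)%:R = \prod_(0 <= i < k) (q%:R - i%:R) :> rat.
Proof.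
elim: k => [|k IHk]; first by rewrite big_nil.
rewrite ffactnSr natrM big_nat_recr //= -IHk; have [kq|qk] := leqP k q.
  by rewrite natrB.
by rewrite ffact_small // !mul0r.
Qed.

Lemma natr_bin (q k : nat) :
  ('C(q, k))%:R = (\prod_(0 <= i < k) (q%:R - i%:R)) / (k`!)%:R :> rat.
Proof.
rewrite -natr_ffact -bin_ffact natrM mulfK // pnatr_eq0 -lt0n; exact: fact_gt0.
Qed.

Lemma X1_bin n (q := (2 ^ n)%N) :
  ('C(q.+1, 13))%:R = (q%:R + 1) * q%:R * (q%:R - 1) * X1 n :> rat.
Proof.
rewrite natr_bin -fact13E /X1; move: (nat_of_bin _) => K.
rewrite -/q -(addn1 q) natrD; move: K%:R^-1 => K'.
by rewrite /index_iota /= !big_cons big_nil; ring.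
Qed.

Lemma natr_xO p : (nat_of_pos (BinNums.xO p))%:R = 2 * (nat_of_pos p)%:R :> rat.
Proof. by rewrite /= NatTrec.trecE -mul2n natrM. Qed.

Lemma natr_xI p : (nat_of_pos (BinNums.xI p))%:R = 2 * (nat_of_pos p)%:R + 1 :> rat.
Proof. by rewrite /= NatTrec.trecE -addn1 natrD -mul2n natrM. Qed.

Lemma X2_bin n (q := (2 ^ n)%N) : (0 < n)%N ->
  ('C(2 ^ n.-1, 6))%:R = q%:R * X2 n :> rat.
Proof.
move=> n0; rewrite natr_bin /X2 /nat_of_bin !(natr_xO, natr_xI) -/q.
have -> : q%:R = 2 * (2 ^ n.-1)%:R :> rat by rewrite /q -{1}(prednK n0) expnS natrM.
move: (2 ^ n.-1)%:R => h.
by rewrite /index_iota /= !big_cons big_nil; field.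
Qed.

Lemma sum_pred_card (T : finType) (P : pred T) :
  \sum_t (P t)%:R = #|[set t | P t]|%:R :> rat.
Proof.
rewrite -natr_sum -sum1_card [in RHS]big_mkcond; congr _%:R.
by apply: eq_bigr => t _; rewrite inE; case: (P t).
Qed.

Section Formula.
Variable F : finFieldType.
Hypothesis two0 : 2 = 0 :> F.
Variable n : nat.
Hypothesis n_gt0 : (0 < n)%N.
Hypothesis cardF : #|F| = (2 ^ n)%N.
Implicit Types t x y : F.

Let q : rat := (2 ^ n)%:R.

(** The contribution of the elements of trace t <> 0 to the number of orbits. *)
Definition trace_weight t : rat :=
  (psi 6 t == 0)%:R / 13
   + ((psi 5 t == 0) && (#|eigenvalues t| == 2%N))%:R / 11
   + ((t == 1) && (#|eigenvalues t| == 2%N))%:R * X3 n.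

Lemma order_eq_psi d k t :
    (1 < d)%N -> (forall k, (d %| k)%N = (cheb t k == 0)) ->
  prime k.*2.+1 -> (d == k.*2.+1)%N = (psi k t == 0).
Proof.
move=> d1 dE pk; rewrite -cheb_psi // -dE; apply/eqP/idP => [->//|dk].
by apply/prime_nt_dvdP => //; rewrite gtn_eqF.
Qed.

(** There are q (q - 1 + r) matrices of trace t, and d m = q + 1 - r orbits of
    length d; the product (q - 1 + r) (q + 1 - r) is (q - 1) (q + 1) for r = 0
    and for r = 2. *)
Lemma sum_trace_weight t : t != 0 ->
  (\sum_(M in [set M in sl2 F | tr2 M == t])
     #|stable_sets (moebius_perm M) 13|)%:R =
  q * (q - 1) * (q + 1) * trace_weight t.
Proof.
move=> t0; have [d [m [d1 qE dE fE]]] := order_of_trace two0 n_gt0 cardF t0.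
set w := (_ + _)%N in fE.
rewrite (eq_bigr (fun => w)); last first.
  by move=> M; rewrite [_ \in _]inE => /andP[MS /eqP Mt]; apply: fE.
rewrite sum_nat_const card_sl2_trace !natrM natrD.
have q0 : (0 < #|F|)%N by rewrite cardF expn_gt0.
rewrite -subn1 natrB //.
have qR : #|F|%:R = q by rewrite cardF.
have := congr1 (fun k => k%:R : rat) qE; rewrite -addn1 !natrD natrM qR => {}qE.
have e6 : (psi 6 t == 0) = (d == 13)%N by rewrite (order_eq_psi d1 dE (k := 6)).
have e5 : (psi 5 t == 0) = (d == 11)%N by rewrite (order_eq_psi d1 dE (k := 5)).
rewrite /w /trace_weight e6 e5.
have -> : (t == 1) = (d == 3)%N.
  rewrite (@order_eq_psi d 1 t d1 dE) // psi1E -subr_eq0; congr (_ == 0).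
  by apply: (@eq_char2 _ two0 _ _ (- 1)); ring.
have [r0|r2] := card_eigenvalues_char2 two0 t0.
  move: (X3 n) => X; rewrite r0 !andbF mul0n natrM !mul0r !addr0.
  have [d13|] := eqVneq d 13%N; last by rewrite !mul0r !mulr0.
  have -> : m%:R = (q + 1) / 13 by rewrite qE r0 d13; field.
  by field.
rewrite r2 /= !andbT mul1n !(natrD, natrM).
have mE : q = 1 + d%:R * m%:R by apply: (addIr 1); rewrite qE r2; ring.
rewrite /X3 -/q natr_bin /index_iota /= !big_cons big_nil.
have -> : 4`!%:R = 24 :> rat by [].
move: (m%:R : rat) (q) mE => M Q ->.
have [->|d13] := eqVneq d 13%N; first by rewrite /=; field.
have [->|d11] := eqVneq d 11%N; first by rewrite /=; field.
have [->|d3] := eqVneq d 3%N; last first.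
  by rewrite /= !mulr0n; field.
by rewrite /= !mulr0n mulr1n; field.
Qed.

Lemma trace_weight0 : trace_weight 0 = 0.
Proof.
rewrite /trace_weight; move: (X3 n) => X; rewrite !psi_at0 // oner_eq0.
by rewrite [0 == 1]eq_sym oner_eq0 /= !mul0r !addr0.
Qed.

Lemma N13_sum :
  (N13 F)%:R * (q * ((q - 1) * (q + 1))) =
    'C((2 ^ n).+1, 13)%:R + (q - 1) * (q + 1) * 'C(2 ^ n.-1, 6)%:R +
    q * (q - 1) * (q + 1) * \sum_t trace_weight t.
Proof.
have qR : #|F|%:R = q by rewrite cardF.
have q0 : (0 < #|F|)%N by rewrite cardF expn_gt0.
have p1 : (#|F|.-1)%:R = q - 1 by rewrite -subn1 natrB // qR.
have s1 : (#|F|.+1)%:R = q + 1 by rewrite -addn1 natrD qR.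
rewrite -s1 -p1 -{1}qR -!natrM -card_sl2 (N13_burnside two0 n_gt0 cardF).
rewrite sum_sl2_trace (bigD1 0) // (sum_trace0 two0 n_gt0 cardF).
rewrite cardF 2!natrD natrM.
congr (_ + _); rewrite natr_sum (eq_bigr _ sum_trace_weight) -big_distrr /=.
by rewrite -cardF !natrM p1 s1 qR [in RHS](bigD1 0) //= trace_weight0 add0r.
Qed.

Lemma sum_trace_weight_card :
  \sum_t trace_weight t = #|[set t : F | psi 6 t == 0]|%:R / 13
   + #|[set t : F | (psi 5 t == 0) && (#|eigenvalues t| == 2%N)]|%:R / 11
   + (#|eigenvalues (1 : F)| == 2%N)%:R * X3 n.
Proof.
rewrite /trace_weight; move: (X3 n) => X.
rewrite !big_split /= -!big_distrl /= !sum_pred_card.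
congr (_ + _ * _); congr _%:R; case: eqP => e2.
  apply/eqP/cards1P; exists 1; apply/setP=> t; rewrite !inE.
  by case: eqP => // ->; rewrite e2.
by apply: eq_card0 => t; rewrite !inE; case: eqP => // ->; apply/eqP.
Qed.

Lemma N13_formula : (N13 F)%:R = X1 n + X2 n + \sum_t trace_weight t.
Proof.
have q1 : q - 1 != 0.
  rewrite subr_eq0 /q -[1]/(1%:R) eqr_nat; case: n n_gt0 => // k _.
  by rewrite expnS; lia.
have qn0 : q != 0 by rewrite /q pnatr_eq0 expn_eq0.
have qp1 : q + 1 != 0 by rewrite /q -[1]/(1%:R) -natrD pnatr_eq0 addn1.
have := N13_sum; rewrite (X1_bin n) (X2_bin n_gt0).
move: (X1 n) (X2 n) => A B E.
apply: (mulIf (mulf_neq0 qn0 (mulf_neq0 q1 qp1))); rewrite E -/q.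
by move: (q) => Q; ring.
Qed.

End Formula.

(** * Counting the traces of order 3, 11 and 13 *)

Lemma expn_mod_period b e p m :
  (b ^ e = 1 %[mod p] -> b ^ m = b ^ (m %% e) %[mod p])%N.
Proof.
move=> be; rewrite {1}(divn_eq m e) expnD mulnC [(_ * e)%N]mulnC expnM.
by rewrite -modnMmr -modnXm be modnXm exp1n modnMmr muln1.
Qed.

Lemma expn_order b e p m : (0 < e)%N -> (b ^ e = 1 %[mod p])%N ->
  (forall i, (0 < i < e)%N -> b ^ i != 1 %[mod p])%N ->
  (b ^ m == 1 %[mod p])%N = (e %| m)%N.
Proof.
move=> e0 be bi; rewrite (expn_mod_period m be) /dvdn.
have [->|r0] := eqVneq (m %% e)%N 0%N; first by rewrite eqxx.
by apply/negbTE/bi; rewrite lt0n r0 ltn_mod.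
Qed.

Section Traces.
Variable F : finFieldType.
Hypothesis two0 : 2 = 0 :> F.
Variable n : nat.
Hypothesis n_gt0 : (0 < n)%N.
Hypothesis cardF : #|F| = (2 ^ n)%N.
Implicit Types t x y : F.

Lemma psi_root_neq0 k t : psi k t = 0 -> t != 0.
Proof.
move=> pt; apply/eqP => t0; move: pt; rewrite t0 psi_at0 // => /eqP.
by rewrite oner_eq0.
Qed.

Lemma psi_order k t : t != 0 -> psi k t = 0 -> prime k.*2.+1 ->
  exists m, #|F|.+1 = (#|eigenvalues t| + k.*2.+1 * m)%N.
Proof.
move=> t0 pt pk; have [d [m [d1 qE dE _]]] := order_of_trace two0 n_gt0 cardF t0.
exists m; have := order_eq_psi two0 d1 dE pk; rewrite pt eqxx.
by move=> /eqP <-; exact: qE.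
Qed.

Lemma psi_root_exp k t : t != 0 -> psi k t = 0 -> prime k.*2.+1 ->
  (2 ^ (n * 2) = 1 %[mod k.*2.+1])%N.
Proof.
move=> t0 pt pk; have [m] := psi_order t0 pt pk.
rewrite expnM cardF; move: (2 ^ n)%N (k.*2.+1) (expn_gt0 2 n) => q p /= q0 qE.
case: (card_eigenvalues_char2 two0 t0) => r; rewrite r in qE.
  have -> : (q ^ 2 = m * (q - 1) * p + 1)%N by nia.
  by rewrite modnMDl.
have -> : (q ^ 2 = m * (q + 1) * p + 1)%N by nia.
by rewrite modnMDl.
Qed.

(** From q + 1 = r + p m with p = 2k + 1 > 2, exactly one of r = 2 and r = 0
    agrees with q = 1 modulo p. *)
Lemma psi_root_split k t : t != 0 -> psi k t = 0 -> prime k.*2.+1 ->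
  (#|eigenvalues t| == 2%N) = (2 ^ n == 1 %[mod k.*2.+1])%N.
Proof.
move=> t0 pt pk; have [m] := psi_order t0 pt pk; rewrite cardF.
have : (2 < k.*2.+1)%N by case: k pk {pt} => [|[|k]].
case: (card_eigenvalues_char2 two0 t0) => ->; rewrite eqn_mod_dvd ?expn_gt0 //;
  move: (2 ^ n)%N (k.*2.+1) (expn_gt0 2 n) => q p /= q0 p2 qE.
  apply/esym/negbTE/negP => /dvdnP[j qj].
  have : (p %| 2)%N by apply/dvdnP; exists (m - j)%N; rewrite mulnBl; nia.
  by move/dvdn_leq => /(_ isT); lia.
by apply/esym/dvdnP; exists m; nia.
Qed.

(** X^q - X is the product of the X - t over all t in F, so all the roots of a
    divisor lie in F and are simple. *)
Lemma roots_psi_poly k (P : {poly F}) e : P %| 'X^(2 ^ e) - 'X ->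
  (forall t, P.[t] = psi k t) -> (e %| n)%N ->
  #|[set t : F | psi k t == 0]| = (size P).-1.
Proof.
move=> PX PE /dvdnP[j nE].
rewrite -card_roots_dvd; last by rewrite cardF nE mulnC expnM dvdp_XpowX.
by apply: eq_card => t; rewrite !inE /root PE.
Qed.

Lemma size_psi_poly5 : size (psi_poly5 F) = 6%N.
Proof.
rewrite /psi_poly5 -!addrA size_polyDl ?size_polyXn //.
do 2!(apply: leq_ltn_trans (size_polyD _ _) _; rewrite gtn_max size_polyXn /=).
by rewrite -polyC1 size_XaddC.
Qed.

Lemma size_psi_poly6 : size (psi_poly6 F) = 7%N.
Proof.
rewrite /psi_poly6 -!addrA size_polyDl ?size_polyXn //.
do 2!(apply: leq_ltn_trans (size_polyD _ _) _; rewrite gtn_max size_polyXn /=).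
by rewrite -polyC1 size_XaddC.
Qed.

Lemma card_psi6 :
  #|[set t : F | psi 6 t == 0]| = (if (6 %| n)%N then 6 else 0)%N.
Proof.
case: ifP => [d6|/negP nd].
  rewrite (roots_psi_poly (psi_poly6_dvd two0)) ?size_psi_poly6 // => t.
  by rewrite psi6E // /psi_poly6 !hornerE.
apply: eq_card0 => t; rewrite !inE; apply/negP => /eqP pt; apply: nd.
suff : (12 %| n * 2)%N by lia.
rewrite -(@expn_order 2 12 13) ?(psi_root_exp (psi_root_neq0 pt) pt) //.
by case=> [|i] //=; do 11?[case: i => [|i] //].
Qed.

Lemma card_psi5_split :
  #|[set t : F | (psi 5 t == 0) && (#|eigenvalues t| == 2%N)]| =
  (if (10 %| n)%N then 5 else 0)%N.
Proof.
have spl t : psi 5 t = 0 -> (#|eigenvalues t| == 2%N) = (10 %| n)%N.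
  move=> pt; rewrite (psi_root_split (psi_root_neq0 pt) pt) //.
  rewrite (@expn_order 2 10 11) //.
  by case=> [|i] //=; do 9?[case: i => [|i] //].
case: ifP => [d10|/negP nd].
  have d5 : (5 %| n)%N by lia.
  have PE t : (psi_poly5 F).[t] = psi 5 t.
    by rewrite psi5E // /psi_poly5 !hornerE.
  have := roots_psi_poly (psi_poly5_dvd two0) PE d5.
  rewrite size_psi_poly5 => c5.
  rewrite -[RHS]c5; apply: eq_card => t; rewrite !inE; case: eqP => //= pt.
  by rewrite (spl _ pt) d10.
by apply: eq_card0 => t; rewrite !inE; apply/negP => /andP[/eqP/spl ->].
Qed.

Lemma eigenvalues1_split : (#|eigenvalues (1 : F)| == 2%N) = ~~ odd n.
Proof.
have p1 : psi 1 (1 : F) = 0 by rewrite psi1E // -[1 + 1]/(2%:R).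
rewrite (psi_root_split (oner_neq0 F) p1) // (@expn_order 2 2 3) ?dvdn2 //.
by case=> [|[|i]].
Qed.

Lemma N13_total :
  (N13 F)%:R = X1 n + X2 n + (~~ odd n)%:R * X3 n
    + ((6 %| n)%N)%:R * (6 / 13) + ((10 %| n)%N)%:R * (5 / 11).
Proof.
rewrite (N13_formula two0 n_gt0 cardF) sum_trace_weight_card.
rewrite card_psi6 card_psi5_split eigenvalues1_split.
move: (X1 n) (X2 n) (X3 n) => A B C.
by case: (6 %| n)%N; case: (10 %| n)%N; rewrite /= ?mulr0n; ring.
Qed.

End Traces.

Theorem proposition4p3 (n : nat) (F : finFieldType)
    (hn : (1 <= n)%N) (hF : #|F| = (2 ^ n)%N) :
  [/\ (n %% 60)%N \in [:: 2; 4; 8; 14; 16; 22; 26; 28; 32; 34; 38; 44; 46;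
                          52; 56; 58]%N ->
        (N13 F)%:R = Xtot n,
      (n %% 60)%N \in [:: 10; 20; 40; 50]%N ->
        (N13 F)%:R = Xtot n + 5 / 11,
      (n %% 60)%N \in [:: 6; 12; 18; 24; 36; 42; 48; 54]%N ->
        (N13 F)%:R = Xtot n + 6 / 13,
      (n %% 60)%N \in [:: 0; 30]%N ->
        (N13 F)%:R = Xtot n + 131 / 143
    & odd n ->
        (N13 F)%:R = X1 n + X2 n].
Proof.
have two0 : 2 = 0 :> F.
  by have /andP[_ /eqP] := card_finPcharP hF (isT : prime 2).
rewrite (N13_total two0 hn hF) /Xtot; move: (X1 n) (X2 n) (X3 n) => A B C.
have dvd60 d : (d %| 60)%N -> (d %| n)%N = (d %| n %% 60)%N.
  by move=> d60; rewrite /dvdn modn_dvdm.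
have o60 : odd n = odd (n %% 60) by apply: negb_inj; rewrite -!dvdn2 dvd60.
rewrite o60 !dvd60 //; move: (n %% 60)%N => r.
have byAll (P : pred nat) rs : r \in rs -> all P rs -> P r.
  by move=> rin /allP; apply.
split=> [rin|rin|rin|rin|ro].
- have /and3P[-> /negPf-> /negPf->] :=
    byAll (fun r => [&& ~~ odd r, ~~ (6 %| r) & ~~ (10 %| r)])%N _ rin isT.
  by rewrite /= !mulr0n; field.
- have /and3P[-> /negPf-> ->] :=
    byAll (fun r => [&& ~~ odd r, ~~ (6 %| r) & 10 %| r])%N _ rin isT.
  by rewrite /= mulr0n; field.
- have /and3P[-> -> /negPf->] :=
    byAll (fun r => [&& ~~ odd r, 6 %| r & ~~ (10 %| r)])%N _ rin isT.
  by rewrite /= mulr0n; field.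
- have /and3P[-> -> ->] :=
    byAll (fun r => [&& ~~ odd r, 6 %| r & 10 %| r])%N _ rin isT.
  by rewrite /=; field.
have odd_ndvd d : (2 %| d)%N -> (d %| r)%N = false.
  by move=> d2; apply: contraTF ro => /(dvdn_trans d2); rewrite dvdn2.
by rewrite ro !odd_ndvd //= !mulr0n; field.
Qed.
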